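(* Let $\beta,\psi_0$ be real constants, $\kappa>0$, $K\neq0$, and $I=\{r>0: r>K\}$. Set $\tilde{\mathcal{C}}\equiv0$, $\mathcal{V}\equiv0$, $\mathcal{A}(\psi)=-\frac{\beta}{8}\psi^2$, and $$A(r)=1-\frac{K}{r},\qquad C(r)=1,\qquad \psi(r)=-\frac{2\psi_0\sqrt r}{K\sqrt{r-K}} .$$ Then $E^{(1)}_{tt}=E^{(1)}_{rr}=E^{(1)}_{\vartheta\vartheta}=E^{(1)}_{\psi}=0$ hold on $I$. Thus the (asymptotically flat, extremal-Reissner–Nordström-type) metric ${\rm d}s^2=(1-\frac Kr)^2{\rm d}t^2-(1-\frac Kr)^{-2}{\rm d}r^2-r^2{\rm d}\Omega^2$ carries this non-trivial scalar field as a solution of the real-tetrad vacuum field equations.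
   Context: Metric ansatz ${\rm d}s^2=A(r)^2{\rm d}t^2-\frac{C(r)^2}{A(r)^2}{\rm d}r^2-r^2{\rm d}\Omega^2$, $\psi=\psi(r)$. Primes on $A,C,\psi$ are $r$-derivatives; $\mathcal{A}',\tilde{\mathcal{C}}',\tilde{\mathcal{C}}'',\mathcal{V}'$ are $\psi$-derivatives evaluated at $\psi(r)$. The real-tetrad reduced vacuum field equations of the scalar-torsion theory are: $E^{(1)}_{tt}:\ 0=\mathcal{A}\frac{A^2(-2rACA'-A^2(C-2rC')+C^3)}{r^2C^3}+\tilde{\mathcal{C}}'\Big(\frac{A^4\psi''}{C^2}-\frac{A^3\psi'(-rCA'+rAC'-2C^2)}{rC^3}\Big)-\frac{2A^3(A-C)\psi'\mathcal{A}'}{rC^2}+\frac{A^4\psi'^2\tilde{\mathcal{C}}''}{C^2}-\frac{\beta A^4\psi'^2}{2C^2}+\kappa^2A^2\mathcal{V}$; $E^{(1)}_{rr}:\ 0=-\frac{(2rAA'+A^2-C^2)\mathcal{A}}{r^2A^2}+\big(\frac{A'}{A}+\frac2r\big)\psi'\tilde{\mathcal{C}}'+\frac{\kappa^2C^2\mathcal{V}}{A^2}+\frac12\beta\psi'^2$; $E^{(1)}_{\vartheta\vartheta}:\ 0=-\frac{A\psi'(rA'+A-C)\mathcal{A}'}{rC^2}+\tilde{\mathcal{C}}'\Big(\frac{A\psi'(rCA'-rAC'+C^2)}{rC^3}+\frac{A^2\psi''}{C^2}\Big)+\frac{\mathcal{A}(-rCA'^2+A(rA'C'-C(rA''+2A'))+A^2C')}{rC^3}+\frac{A^2\psi'^2\tilde{\mathcal{C}}''}{C^2}-\frac{\beta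 A^2\psi'^2}{2C^2}+\kappa^2\mathcal{V}$; $E^{(1)}_{\psi}:\ 0=\frac{(A-C)(2rA'+A-C)\mathcal{A}'}{r^2C^2}+\frac{\beta A\psi'(2rCA'+A(2C-rC'))}{rC^3}+\frac{\beta A^2\psi''}{C^2}+\kappa^2\mathcal{V}'+\frac{\tilde{\mathcal{C}}'(rCA'(rA'-2C)+A(-r^2A'C'+rC(rA''+6A')-2C^2)+2A^2(C-rC'))}{r^2C^3}$. *)

(* Defs.v *)
From Stdlib Require Import Reals.
From Coquelicot Require Import Coquelicot.
Open Scope R_scope.

(* Reduced real-tetrad vacuum field equations, written as functions of the
   pointwise values.  Arguments:
   b = beta, k = kappa, r = radius,
   A A1 A2 = A, A', A''   ;  C C1 = C, C'  ;  p1 p2 = psi', psi''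
   cA cA1 = calA(psi), calA'(psi) ; Ct1 Ct2 = tildeC'(psi), tildeC''(psi)
   V V1 = calV(psi), calV'(psi). *)

Definition E_tt (b k r A A1 C C1 p1 p2 cA cA1 Ct1 Ct2 V : R) : R :=
  cA * (A^2 * (-2*r*A*C*A1 - A^2*(C - 2*r*C1) + C^3) / (r^2 * C^3))
  + Ct1 * (A^4 * p2 / C^2 - A^3 * p1 * (-r*C*A1 + r*A*C1 - 2*C^2) / (r*C^3))
  - 2*A^3*(A - C)*p1*cA1 / (r*C^2)
  + A^4 * p1^2 * Ct2 / C^2
  - b*A^4*p1^2 / (2*C^2)
  + k^2 * A^2 * V.

Definition E_rr (b k r A A1 C p1 cA Ct1 V : R) : R :=
  - (2*r*A*A1 + A^2 - C^2) * cA / (r^2 * A^2)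
  + (A1 / A + 2 / r) * p1 * Ct1
  + k^2 * C^2 * V / A^2
  + 1/2 * b * p1^2.

Definition E_thth (b k r A A1 A2 C C1 p1 p2 cA cA1 Ct1 Ct2 V : R) : R :=
  - A * p1 * (r*A1 + A - C) * cA1 / (r*C^2)
  + Ct1 * (A * p1 * (r*C*A1 - r*A*C1 + C^2) / (r*C^3) + A^2 * p2 / C^2)
  + cA * (-r*C*A1^2 + A*(r*A1*C1 - C*(r*A2 + 2*A1)) + A^2*C1) / (r*C^3)
  + A^2 * p1^2 * Ct2 / C^2
  - b*A^2*p1^2 / (2*C^2)
  + k^2 * V.

Definition E_psi (b k r A A1 A2 C C1 p1 p2 cA1 Ct1 V1 : R) : R :=
  (A - C) * (2*r*A1 + A - C) * cA1 / (r^2 * C^2)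
  + b * A * p1 * (2*r*C*A1 + A*(2*C - r*C1)) / (r*C^3)
  + b * A^2 * p2 / C^2
  + k^2 * V1
  + Ct1 * (r*C*A1*(r*A1 - 2*C) + A*(-r^2*A1*C1 + r*C*(r*A2 + 6*A1) - 2*C^2)
           + 2*A^2*(C - r*C1)) / (r^2 * C^3).

Definition field_eqs_hold (b k : R) (A C psi cA Ct V : R -> R) (r : R) : Prop :=
  let A0 := A r in
  let A1 := Derive A r in
  let A2 := Derive (Derive A) r in
  let C0 := C r in
  let C1 := Derive C r in
  let p := psi r in
  let p1 := Derive psi r in
  let p2 := Derive (Derive psi) r in
  let cA0 := cA p in
  let cA1 := Derive cA p in
  let Ct1 := Derive Ct p in
  let Ct2 := Derive (Derive Ct) p in
  let V0 := V p in
  let V1 := Derive V p in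
  E_tt b k r A0 A1 C0 C1 p1 p2 cA0 cA1 Ct1 Ct2 V0 = 0 /\
  E_rr b k r A0 A1 C0 p1 cA0 Ct1 V0 = 0 /\
  E_thth b k r A0 A1 A2 C0 C1 p1 p2 cA0 cA1 Ct1 Ct2 V0 = 0 /\
  E_psi b k r A0 A1 A2 C0 C1 p1 p2 cA1 Ct1 V1 = 0.

(* Main.v *)
Require Import Defs.
From Stdlib Require Import Reals Lra.
From Coquelicot Require Import Coquelicot.
Open Scope R_scope.

(* The proof separates analysis from algebra.  Writing s = sqrt r and
   t = sqrt (r - K), so that r = s^2 and K = s^2 - t^2, all quantities become
   rational functions of s and t, and the four equations turn into rational
   identities in s, t, beta, kappa, psi0, checked by [field].  The theorem
   follows by rewriting with the derivative formulas and applying that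
   algebraic lemma. *)

(* The exterior region {r | 0 < r /\ K < r} is a neighbourhood of each of its
   points; second derivatives are computed from first derivatives valid there. *)
Lemma exterior_locally (K r : R) :
  0 < r -> K < r -> locally r (fun y => 0 < y /\ K < y).
Proof.
  intros Hr HKr.
  apply filter_and; [exact (open_gt 0 r Hr) | exact (open_gt K r HKr)].
Qed.

Lemma Derive2_const (a x : R) : Derive (Derive (fun _ : R => a)) x = 0.
Proof.
  rewrite (Derive_ext _ (fun _ => 0)); [apply Derive_const | apply Derive_const].
Qed.

Lemma Derive_lapse (K y : R) : 0 < y -> Derive (fun x => 1 - K / x) y = K / y^2.
Proof.
  intros Hy. apply is_derive_unique. auto_derive; [lra | field; lra].
Qed.

Lemma Derive2_lapse (K r : R) : 0 < r ->
  Derive (Derive (fun x => 1 - K / x)) r = - 2 * K / r^3.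
Proof.
  intros Hr.
  rewrite (Derive_ext_loc _ (fun y => K / y^2)).
  - apply is_derive_unique. auto_derive; [nra | field; lra].
  - apply (filter_imp (fun y => 0 < y)); [|exact (open_gt 0 r Hr)].
    exact (Derive_lapse K).
Qed.

Lemma sqrt_coordinates (K x : R) : 0 < x -> K < x ->
  0 < sqrt x /\ 0 < sqrt (x - K) /\
  x = sqrt x * sqrt x /\ K = sqrt x * sqrt x - sqrt (x - K) * sqrt (x - K).
Proof.
  intros Hx HKx.
  rewrite !sqrt_sqrt by lra.
  repeat split; try lra; apply sqrt_lt_R0; lra.
Qed.

Lemma Derive_scalar (K c y : R) : K <> 0 -> 0 < y -> K < y ->
  Derive (fun x => - (2 * c * sqrt x) / (K * sqrt (x - K))) y
  = c / (sqrt y * sqrt (y - K) ^ 3).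
Proof.
  intros HK Hy HKy. apply is_derive_unique.
  destruct (sqrt_coordinates K y Hy HKy) as (Hs & Ht & Hsy & HsK).
  replace (y - K) with (y + - K) in * by ring.
  auto_derive.
  - repeat split; try lra.
    apply Rmult_integral_contrapositive_currified; lra.
  - set (s := sqrt y) in *. set (t := sqrt (y + - K)) in *.
    clearbody s t. subst y K.
    field. repeat split; lra.
Qed.

Lemma Derive2_scalar (K c r : R) : K <> 0 -> 0 < r -> K < r ->
  Derive (Derive (fun x => - (2 * c * sqrt x) / (K * sqrt (x - K)))) r
  = c * (- / (2 * sqrt r ^ 3 * sqrt (r - K) ^ 3) - 3 / (2 * sqrt r * sqrt (r - K) ^ 5)).
Proof.
  intros HK Hr HKr.
  rewrite (Derive_ext_loc _ (fun y => c / (sqrt y * sqrt (y - K) ^ 3))).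
  - apply is_derive_unique.
    destruct (sqrt_coordinates K r Hr HKr) as (Hs & Ht & Hsr & HsK).
    replace (r - K) with (r + - K) in * by ring.
    auto_derive.
    + repeat split; try lra.
      repeat apply Rmult_integral_contrapositive_currified; lra.
    + set (s := sqrt r) in *. set (t := sqrt (r + - K)) in *.
      clearbody s t. subst r K.
      field. repeat split; lra.
  - apply (filter_imp (fun y => 0 < y /\ K < y)); [|now apply exterior_locally].
    intros y [Hy HKy]. now apply Derive_scalar.
Qed.

Lemma Derive_coupling (b p : R) : Derive (fun s => - (b / 8) * s^2) p = - (b / 4) * p.
Proof. apply is_derive_unique. auto_derive; [auto | field]. Qed.

Lemma exterior_field_identities (b k c K r s t : R) :
  0 < s -> 0 < t -> r = s * s -> K = s * s - t * t -> K <> 0 ->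
  let A := 1 - K / r in
  let A1 := K / r^2 in
  let A2 := - 2 * K / r^3 in
  let p := - (2 * c * s) / (K * t) in
  let p1 := c / (s * t ^ 3) in
  let p2 := c * (- / (2 * s ^ 3 * t ^ 3) - 3 / (2 * s * t ^ 5)) in
  let cA := - (b / 8) * p^2 in
  let cA1 := - (b / 4) * p in
  E_tt b k r A A1 1 0 p1 p2 cA cA1 0 0 0 = 0 /\
  E_rr b k r A A1 1 p1 cA 0 0 = 0 /\
  E_thth b k r A A1 A2 1 0 p1 p2 cA cA1 0 0 0 = 0 /\
  E_psi b k r A A1 A2 1 0 p1 p2 cA1 0 0 = 0.
Proof.
  intros Hs Ht -> -> HK. cbv zeta.
  unfold E_tt, E_rr, E_thth, E_psi.
  repeat split; field; repeat split; nra.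
Qed.

Theorem mainTheorem4 (beta psi0 kappa K : R) :
  0 < kappa -> K <> 0 ->
  forall r : R, 0 < r -> K < r ->
    field_eqs_hold beta kappa
      (fun x => 1 - K / x)                                    (* A *)
      (fun _ => 1)                                            (* C *)
      (fun x => - (2 * psi0 * sqrt x) / (K * sqrt (x - K)))   (* psi *)
      (fun s => - (beta / 8) * s^2)                           (* calA *)
      (fun _ => 0)                                            (* tildeC *)
      (fun _ => 0)                                            (* calV *)
      r.
Proof.
  intros _ HK r Hr HKr.
  unfold field_eqs_hold. cbv zeta.
  rewrite Derive_lapse, Derive2_lapse, Derive_scalar, Derive2_scalar,
    Derive_coupling, !Derive_const, Derive2_const by assumption.
  destruct (sqrt_coordinates K r Hr HKr) as (Hs & Ht & Hsr & HsK).
  exact (exterior_field_identities beta kappa psi0 K r _ _ Hs Ht Hsr HsK HK).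
Qed.
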